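(* There exist choices of the data described in the context (a number of agents $N$, block sizes $n_i$, a constraint set $\mathcal{X}$, functions $Q(\cdot), r(\cdot)$, and sampling time sets $\mathcal{T}^1,\dots,\mathcal{T}^N$) satisfying all of the assumptions (A1)-(A4) listed there, for which asynchronous sampling of the strongly convex quadratic objective $f$ leads to a nonconvex aggregate problem; that is, for some $t_z\in\mathcal{T}_s$ the aggregate objective $x \mapsto g(x;t_z)$ is not convex on $\mathcal{X}$.
   Context: For $n=\sum_{i=1}^N n_i$ and an $n\times n$ matrix $A$, $A^{[i]}$ denotes the $i$-th block of rows of $A$ (the first $n_1$ rows for $i=1$, the next $n_2$ rows for $i=2$, etc.); for $v\in\mathbb{R}^n$, $v^{[i]}\in\mathbb{R}^{n_i}$ denotes the $i$-th block of entries. $\|\cdot\|$ is the Euclidean (induced) norm. Sampled problem: for times $t$ of the form $t=\ell t_s$, $\ell\in\mathbb{N}_0$, with a fixed sampling period $t_s>0$, minimize over $x\in\mathcal{X}$ the function $f(x;t) = x^T Q(t)x + r(t)^T x$. For some constants $\bar u>0$ and $0<\varphi<\psi$, each $f(\cdot;t)$ satisfies $\|\nabla_x f(x;t)\|\le\bar u$ and $\varphi I_n\preceq\nabla_x^2 f(x;t)\preceq\psi I_n$ for all $x\in\mathcal{X}$. Sampling: agent $i\in\{1,\dots,N\}$ samples the objective only at the times in a set $\mathcal{T}^i\subseteq\{\ell t_s:\ell\in\mathbb{N}_0\}$. Put $\mathcal{T}_s=\bigcup_{i=1}^N\mathcal{T}^i=\{t_0,t_1,\dots\}$ (in increasing order),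 and $\theta_i(t_z)=\max\{t\in\mathcal{T}^i: t\le t_z\}$, the time of agent $i$'s latest sample not after $t_z$. Aggregate problem: for $t_z\in\mathcal{T}_s$, minimize over $x\in\mathcal{X}$ the function $g(x;t_z)=x^T\Upsilon(t_z)x+\Xi(t_z)^Tx$, where $\Upsilon(t_z)$ is the $n\times n$ matrix whose $i$-th block of rows is $Q^{[i]}(\theta_i(t_z))$ and $\Xi(t_z)\in\mathbb{R}^n$ is the vector whose $i$-th block is $r^{[i]}(\theta_i(t_z))$. Assumptions. (A1) $Q(t)=Q(t)^T\succeq\xi I_n$ for all $t$, for some $\xi>0$. (A2) $\mathcal{X}=\mathcal{X}_1\times\dots\times\mathcal{X}_N$ with each $\mathcal{X}_i\subseteq\mathbb{R}^{n_i}$ non-empty, compact and polyhedral. (A3) For each $i$ there are $L_Q^{[i]},L_r^{[i]}>0$ with $\|Q^{[i]}(t)-Q^{[i]}(t')\|\le L_Q^{[i]}|t-t'|$ and $\|r^{[i]}(t)-r^{[i]}(t')\|\le L_r^{[i]}|t-t'|$ for all $t,t'$ in the time horizon. (A4) There is $\Delta>0$ with $|\theta_i(t_{z+1})-\theta_i(t_z)|\le\Delta$ for all $i$ and all $z$. *)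

(* Defs.v *)
From HB Require Import structures.
From mathcomp Require Import all_boot all_order all_algebra.
From mathcomp Require Import all_classical all_reals all_analysis.

Set Implicit Arguments.
Unset Strict Implicit.
Unset Printing Implicit Defensive.

Import Order.TTheory GRing.Theory Num.Theory.
Import numFieldNormedType.Exports.

Local Open Scope classical_set_scope.
Local Open Scope ring_scope.

(* The norm `|v| of the library on matrices is the sup norm, hence these two
   definitions of the Euclidean norm and of the matrix norm it induces. *)
Definition enorm (R : realType) (n : nat) (v : 'cV[R]_n) : R :=
  Num.sqrt (\sum_(i < n) v i 0 ^+ 2).

Definition opnorm (R : realType) (m n : nat) (A : 'M[R]_(m, n)) : R :=
  sup [set enorm (A *m v) | v in [set v : 'cV[R]_n | enorm v <= 1]].

Definition psd (R : realType) (n : nat) (A : 'M[R]_n) : Prop :=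
  A^T = A /\ forall v : 'cV[R]_n, 0 <= (v^T *m A *m v) 0 0.

Definition loewner_le (R : realType) (n : nat) (A B : 'M[R]_n) : Prop :=
  psd (B - A).

(* Partial derivatives are directional derivatives along the canonical basis
   vectors delta_mx i 0.  Only quadratic polynomials are differentiated below,
   so all of these derivatives exist. *)
Definition gradient (R : realType) (n : nat) (f : 'cV[R]_n -> R)
    (x : 'cV[R]_n) : 'cV[R]_n :=
  \col_(i < n) 'D_(delta_mx i 0) (f : 'cV[R]_n -> R^o) x.

Definition hessian (R : realType) (n : nat) (f : 'cV[R]_n -> R)
    (x : 'cV[R]_n) : 'M[R]_n :=
  \matrix_(i < n, j < n)
    'D_(delta_mx j 0) ((fun y => gradient f y i 0) : 'cV[R]_n -> R^o) x.

Definition polyhedral (R : realType) (n : nat) (S : set 'cV[R]_n) : Prop :=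
  exists (m : nat) (C : 'M[R]_(m, n)) (d : 'cV[R]_m),
    S = [set x | forall j, (C *m x) j 0 <= d j 0].

Definition quadratic (R : realType) (n : nat) (A : 'M[R]_n) (b : 'cV[R]_n)
    (x : 'cV[R]_n) : R :=
  (x^T *m A *m x) 0 0 + (b^T *m x) 0 0.

Definition max_of (R : realType) (A : set R) : R :=
  xget 0 (A `&` ubound A).

(* Agents are numbered from 0.  Qmat and rvec are total functions of time, but
   only their values on time_grid are ever constrained or used.  The sequence
   stime enumerates the union of the sets samples i, see well_formed. *)
Record sampled_problem (R : realType) := SampledProblem {
  nagents : nat;
  bsize : 'I_nagents -> nat;
  period : R;
  Xset : forall i : 'I_nagents, set 'cV[R]_(bsize i);
  Qmat : R -> 'M[R]_(\sum_(i < nagents) bsize i);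
  rvec : R -> 'cV[R]_(\sum_(i < nagents) bsize i);
  samples : 'I_nagents -> set R;
  stime : nat -> R
}.

Arguments bsize {R} P i : rename.
Arguments Xset {R} P i : rename.
Arguments Qmat {R} P t : rename.
Arguments rvec {R} P t : rename.
Arguments samples {R} P i : rename.
Arguments stime {R} P z : rename.

Definition xdim (R : realType) (P : sampled_problem R) : nat :=
  (\sum_(i < nagents P) bsize P i)%N.

Definition time_grid (R : realType) (P : sampled_problem R) : set R :=
  [set t | exists l : nat, t = l%:R * period P].

(* submxcol A i is the i-th block of rows of A, and \mxcol_i B i stacks the
   blocks B i; both also apply to column vectors. *)
Definition Qblock (R : realType) (P : sampled_problem R) (i : 'I_(nagents P))
    (t : R) : 'M[R]_(bsize P i, xdim P) := submxcol (Qmat P t) i.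

Definition rblock (R : realType) (P : sampled_problem R) (i : 'I_(nagents P))
    (t : R) : 'cV[R]_(bsize P i) := submxcol (rvec P t) i.

Arguments Qblock {R} P i t.
Arguments rblock {R} P i t.

Definition feasible (R : realType) (P : sampled_problem R) :
    set 'cV[R]_(xdim P) :=
  [set x | forall i, Xset P i (submxcol x i)].

Arguments feasible {R} P _.

Definition objective (R : realType) (P : sampled_problem R) (t : R) :
    'cV[R]_(xdim P) -> R :=
  quadratic (Qmat P t) (rvec P t).

Arguments objective {R} P t _.

Definition latest_sample (R : realType) (P : sampled_problem R)
    (i : 'I_(nagents P)) (t : R) : R :=
  max_of [set s | samples P i s /\ s <= t].

Arguments latest_sample {R} P i t.

Definition Upsilon (R : realType) (P : sampled_problem R) (t : R) :
    'M[R]_(xdim P) :=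
  \mxcol_(i < nagents P) Qblock P i (latest_sample P i t).

Definition Xi (R : realType) (P : sampled_problem R) (t : R) :
    'cV[R]_(xdim P) :=
  \mxcol_(i < nagents P) rblock P i (latest_sample P i t).

Definition aggregate (R : realType) (P : sampled_problem R) (t : R) :
    'cV[R]_(xdim P) -> R :=
  quadratic (Upsilon P t) (Xi P t).

Arguments aggregate {R} P t _.

(* The last condition makes every maximum defining latest_sample at a time
   stime P z exist: every agent has sampled at least once by then. *)
Definition well_formed (R : realType) (P : sampled_problem R) : Prop :=
  [/\ (0 < nagents P)%N /\ (forall i, (0 < bsize P i)%N),
      0 < period P,
      forall i, samples P i `<=` time_grid P,
      {homo stime P : y z / (y < z)%N >-> y < z} /\
        range (stime P) = \bigcup_i samples P i
    & forall i z, exists s, samples P i s /\ s <= stime P z].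

Definition bounded_derivatives (R : realType) (P : sampled_problem R) : Prop :=
  exists ubar phi psi : R,
    [/\ 0 < ubar, 0 < phi, phi < psi
      & forall t x, time_grid P t -> feasible P x ->
        [/\ enorm (gradient (objective P t) x) <= ubar,
            loewner_le phi%:M (hessian (objective P t) x)
          & loewner_le (hessian (objective P t) x) psi%:M]].

Definition uniformly_posdef (R : realType) (P : sampled_problem R) : Prop :=
  exists2 xi : R, 0 < xi &
    forall t, time_grid P t ->
      Qmat P t = (Qmat P t)^T /\ loewner_le xi%:M (Qmat P t).

Definition polytopic_blocks (R : realType) (P : sampled_problem R) : Prop :=
  forall i, [/\ Xset P i !=set0, compact (Xset P i) & polyhedral (Xset P i)].

Definition lipschitz_data (R : realType) (P : sampled_problem R) : Prop :=
  forall i, exists LQ Lr : R,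
    [/\ 0 < LQ, 0 < Lr
      & forall t t', time_grid P t -> time_grid P t' ->
        opnorm (Qblock P i t - Qblock P i t') <= LQ * `|t - t'| /\
        enorm (rblock P i t - rblock P i t') <= Lr * `|t - t'|].

Definition bounded_sampling_gaps (R : realType) (P : sampled_problem R) :
    Prop :=
  exists2 Delta : R, 0 < Delta &
    forall i z,
      `|latest_sample P i (stime P z.+1) - latest_sample P i (stime P z)|
        <= Delta.

(* Main.v *)
(* Two agents with one variable each use Q(0) = [[5, 2], [2, 1]] and
   Q(t) = [[1, 2], [2, 5]] for t > 0, both positive definite.  At time 1 only
   the first agent has resampled, so the aggregate matrix mixes the first row of
   Q(1) with the second row of Q(0), which gives the indefinite matrix
   [[1, 2], [2, 1]]. *)
Require Import Defs.
From mathcomp Require Import all_boot all_order all_algebra.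
From mathcomp Require Import all_classical all_reals all_analysis.
From mathcomp Require Import ring lra.

Set Implicit Arguments.
Unset Strict Implicit.
Unset Printing Implicit Defensive.

Import Order.TTheory GRing.Theory Num.Theory.
Import numFieldNormedType.Exports.

Local Open Scope classical_set_scope.
Local Open Scope ring_scope.

(** * Gradient and Hessian of a quadratic function *)

Section Quadratic.
Variables (R : realType) (n : nat).

(** For nonzero h the difference quotient at x along v is c + h * d, which tends to c. Gradient and
    Hessian entries are both read off from such explicit expansions. *)
Lemma derive_expansion2 (f : 'cV[R]_n -> R) (x v : 'cV[R]_n) (c d : R) :
  (forall h, f (h *: v + x) = f x + h * c + h ^+ 2 * d) ->
  'D_v (f : 'cV[R]_n -> R^o) x = c.
Proof.
move=> fE; apply: cvg_lim => //.
have : (fun h : R => c + h * d) @ 0^' --> c + 0 * d.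
  apply: cvgD; first exact: cvg_cst.
  apply: cvgM; last exact: cvg_cst.
  exact: cvg_within.
rewrite mul0r addr0; apply: cvg_trans; apply: near_eq_cvg.
near=> h; have h0 : h != 0 by near: h; exact: nbhs_dnbhs_neq.
by rewrite /= fE /GRing.scale/=; field.
Unshelve. all: by end_near. Qed.

Lemma quadratic_shift (A : 'M[R]_n) (b x v : 'cV[R]_n) (h : R) :
  quadratic A b (h *: v + x) =
    quadratic A b x + h * (v^T *m ((A + A^T) *m x + b)) 0 0
    + h ^+ 2 * (v^T *m A *m v) 0 0.
Proof.
(* A 1x1 matrix equals its transpose, so x^T A v = v^T A^T x; this is how A + A^T arises for a
   general A. *)
have trE (B : 'M[R]_1) : B 0 0 = B^T 0 0 by rewrite mxE.
rewrite /quadratic.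
have -> : (b^T *m (h *: v + x)) 0 0 = h * (v^T *m b) 0 0 + (b^T *m x) 0 0.
  rewrite mulmxDr -scalemxAr mxE [in LHS]mxE; congr (_ * _ + _).
  by rewrite trE trmx_mul trmxK.
have -> : (v^T *m ((A + A^T) *m x + b)) 0 0 =
    (v^T *m A *m x) 0 0 + (x^T *m A *m v) 0 0 + (v^T *m b) 0 0.
  rewrite mulmxDr mulmxDl mulmxDr !mulmxA mxE [in LHS]mxE.
  by congr (_ + _ + _); rewrite trE !trmx_mul !trmxK mulmxA.
have -> : (h *: v + x)^T = h *: v^T + x^T by apply/rowP => i; rewrite !mxE.
have mxDE (B C : 'M[R]_1) : (B + C) 0 0 = B 0 0 + C 0 0 by rewrite mxE.
have mxZE a (B : 'M[R]_1) : (a *: B) 0 0 = a * B 0 0 by rewrite mxE.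
rewrite !mulmxDl !mulmxDr -!scalemxAl -!scalemxAr !(mxDE, mxZE).
by ring.
Qed.

Lemma gradient_quadratic (A : 'M[R]_n) (b x : 'cV[R]_n) :
  gradient (quadratic A b) x = (A + A^T) *m x + b.
Proof.
apply/colP => i; rewrite mxE.
rewrite (derive_expansion2 (fun h => quadratic_shift A b x _ h)).
by rewrite trmx_delta -rowE mxE.
Qed.

Lemma hessian_quadratic (A : 'M[R]_n) (b x : 'cV[R]_n) :
  hessian (quadratic A b) x = A + A^T.
Proof.
apply/matrixP => i j; rewrite mxE.
(* Gradient entries are affine, so their expansion has no h^2 term. *)
apply: (@derive_expansion2 _ _ _ _ 0) => h.
rewrite !gradient_quadratic mulmxDr -scalemxAr -colE.
by rewrite !mxE; ring.
Qed.

End Quadratic.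

(** * Block vectors and matrices with all blocks of size one *)

Section ScalarBlocks.
Variables (R : realType) (n : nat).
(* The paper's block sizes n_i, all equal to 1; matrices keep the library's
   block structure because \sum_(i < n) 1 does not reduce to n. *)
Local Notation p := (fun _ : 'I_n => 1%N).
Local Notation N := (\sum_(i < n) p i)%N.
Implicit Types (M : 'M[R]_n) (v : 'cV[R]_N).

Definition coord v (i : 'I_n) : R := @submxcol _ _ p _ v i 0 0.

Definition scalar_blocks M : 'M[R]_N :=
  @mxblock _ _ _ p p (fun i j => (M i j)%:M).

Definition block_col (f : 'I_n -> R) : 'cV[R]_N :=
  @mxcol _ _ p _ (fun i => const_mx (f i)).

Lemma coord_block_col f i : coord (block_col f) i = f i.
Proof. by rewrite /coord mxcolK mxE. Qed.

Lemma coord_lin a b v w i :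
  coord (a *: v + b *: w) i = a * coord v i + b * coord w i.
Proof. by rewrite /coord !mxE. Qed.

Lemma dot_coord v w : (v^T *m w) 0 0 = \sum_i coord v i * coord w i.
Proof.
rewrite -{1}(@submxcolK _ _ p _ v) -{1}(@submxcolK _ _ p _ w).
rewrite tr_mxcol mul_mxrow_mxcol summxE; apply: eq_bigr => i _.
by rewrite mxE big_ord1 mxE.
Qed.

Lemma enorm_coord v : enorm v = Num.sqrt (\sum_i coord v i ^+ 2).
Proof.
congr Num.sqrt; under [RHS]eq_bigr do rewrite expr2.
rewrite -dot_coord mxE; apply: eq_bigr => i _.
by rewrite mxE expr2.
Qed.

Lemma coord_mul M v i :
  coord (scalar_blocks M *m v) i = \sum_j M i j * coord v j.
Proof.
rewrite /coord -submxcol_mul /scalar_blocks mxblockEv mxcolK.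
rewrite -{1}(@submxcolK _ _ p _ v) mul_mxrow_mxcol summxE.
by apply: eq_bigr => j _; rewrite mul_scalar_mx mxE.
Qed.

Lemma form_scalar_blocks M v :
  (v^T *m scalar_blocks M *m v) 0 0 =
    \sum_i \sum_j M i j * coord v i * coord v j.
Proof.
rewrite -mulmxA dot_coord; apply: eq_bigr => i _.
by rewrite coord_mul mulr_sumr; apply: eq_bigr => j _; rewrite mulrCA mulrA.
Qed.

Lemma tr_scalar_blocks M : (scalar_blocks M)^T = scalar_blocks M^T.
Proof.
rewrite tr_mxblock; apply: eq_mxblock => i j.
by rewrite tr_scalar_mx mxE.
Qed.

Lemma scalar_blocksD M M' :
  scalar_blocks M + scalar_blocks M' = scalar_blocks (M + M').
Proof.
rewrite /scalar_blocks -mxblockD; apply: eq_mxblock => i j.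
by rewrite mxE raddfD.
Qed.

(** The three coefficients let one criterion serve every Loewner bound: c = 0 gives a lower bound a
    on b M, while a = 0 and b = -2 give an upper bound c on 2 M. *)
Lemma psd_scalar_blocks_sub (a b c : R) M : M^T = M ->
  (forall v, a * (\sum_i coord v i ^+ 2) <=
     b * (\sum_i \sum_j M i j * coord v i * coord v j)
     + c * (\sum_i coord v i ^+ 2)) ->
  psd (b *: scalar_blocks M + c%:M - a%:M).
Proof.
move=> Msym le; split=> [|v].
  rewrite [LHS]raddfB/= raddfD/= !tr_scalar_mx.
  by rewrite linearZ/= tr_scalar_blocks Msym.
have sqE : (v^T *m v) 0 0 = \sum_i coord v i ^+ 2.
  by rewrite dot_coord; apply: eq_bigr => i _; rewrite expr2.
rewrite mulmxBr mulmxDr mulmxBl mulmxDl -scalemxAr -scalemxAl.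
rewrite !mul_mx_scalar -!scalemxAl; move: (le v).
by rewrite -sqE -form_scalar_blocks !mxE; lra.
Qed.

End ScalarBlocks.

Lemma const_mx_continuous (R : realType) m n :
  continuous (fun a : R => const_mx a : 'M[R]_(m, n)).
Proof.
move=> a; apply/cvg_ballP => e e0; near=> b; split=> // i j; rewrite !mxE.
by near: b; rewrite nbhs_filterE; exact: (nbhsx_ballx a).
Unshelve. all: by end_near. Qed.

(** The point chosen by [xget] is also a maximum, and maxima are unique by antisymmetry. *)
Lemma max_of_eq (R : realType) (A : set R) (m : R) :
  A m -> ubound A m -> max_of A = m.
Proof.
move=> Am ubm; rewrite /max_of.
case: xgetP => [y _ [Ay uby]|/(_ m)]; last by case.
by apply/eqP; rewrite eq_le ubm// uby.
Qed.

(** * The counterexample data and its sampling times *)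

Section Counterexample.
Variable R : realType.

Definition M0 : 'M[R]_2 :=
  \matrix_(i, j) if i != j then 2 else if i == 0 then 5 else 1.
Definition M1 : 'M[R]_2 :=
  \matrix_(i, j) if i != j then 2 else if i == 0 then 1 else 5.
Definition Mt (t : R) := if t == 0 then M0 else M1.

(* The second agent misses the sample at time 1, so that at this time it still
   relies on Q(0). *)
Definition cex_samples (i : 'I_2) : set R :=
  [set t | exists2 l : nat, (i == 0) || (l != 1%N) & t = l%:R].

Definition cex : sampled_problem R :=
  @SampledProblem R 2 (fun=> 1%N) 1
    (fun=> [set x : 'cV[R]_1 | `|x 0 0| <= 1])
    (fun t => scalar_blocks (Mt t))
    (fun=> 0)
    cex_samples
    (fun z => z%:R).

Lemma cex_gridP (t : R) : time_grid cex t -> exists l : nat, t = l%:R.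
Proof. by case=> l ->; exists l; rewrite mulr1. Qed.

Lemma Mt_tr t : (Mt t)^T = Mt t.
Proof.
by rewrite /Mt; case: ifP => _; apply/matrixP => i j; rewrite !mxE eq_sym;
  case: eqVneq => // ->.
Qed.

(** Away from time 1 both agents sample at z itself; up to time 1 the second agent has only its
    sample at 0. *)
Lemma cex_latest (i : 'I_2) (z : nat) :
  latest_sample cex i z%:R = (if (i != 0) && (z == 1%N) then 0 else z)%:R.
Proof.
apply: max_of_eq => /=.
  split; last by rewrite ler_nat; case: ifP.
  eexists; last reflexivity.
  by case: eqVneq => //= _; case: ifP => // /negbT.
move=> _ [[l il ->]]; rewrite !ler_nat; case: ifP => //.
by move=> /andP[i0 /eqP ->]; case: l il => [|[|]]//; rewrite (negPf i0).
Qed.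

Lemma cex_well_formed : well_formed cex.
Proof.
split=> //=.
- by move=> i _ [l _ ->]; exists l; rewrite mulr1.
- split=> [y z|]; first by rewrite ltr_nat.
  apply/seteqP; split=> [_ [z _ <-]|_ [i _ [l _ ->]]]; last by exists l.
  (* The first agent samples at every natural number, so the union of the sample sets is the whole
     grid. *)
  by exists (0 : 'I_2) => //; exists z.
- move=> i z; exists 0; split; last exact: ler0n.
  by exists 0%N; rewrite ?orbT.
Qed.

(** * Positive definiteness and bounds on the derivatives *)

Lemma ord2P (i : 'I_2) : {i = 0} + {i = 1}.
Proof. by case: i => [[|[|//]] ?]; [left|right]; exact/val_inj. Qed.

Lemma sum_ord2 (F : 'I_2 -> R) : \sum_i F i = F 0 + F 1.
Proof.
by rewrite !big_ord_recl big_ord0 addr0; congr (_ + F _); apply/val_inj.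
Qed.

Lemma cex_form t (v : 'cV[R]_(xdim cex)) :
  \sum_i \sum_j Mt t i j * coord v i * coord v j =
    (if t == 0 then 5 else 1) * coord v 0 ^+ 2 + 4 * coord v 0 * coord v 1
    + (if t == 0 then 1 else 5) * coord v 1 ^+ 2.
Proof.
by rewrite !sum_ord2 /Mt; case: ifP => _; rewrite !mxE/=; ring.
Qed.

(** Both matrices have eigenvalues 3 - 2 sqrt 2 and 3 + 2 sqrt 2; the smaller, about 0.17, exceeds
    1/10. *)
Lemma cex_form_ge t (v : 'cV[R]_(xdim cex)) :
  \sum_i coord v i ^+ 2 <=
    10 * \sum_i \sum_j Mt t i j * coord v i * coord v j.
Proof.
rewrite cex_form sum_ord2; set a := coord v 0; set b := coord v 1.
(* Completing the square at time 0: nine times the gap 49 a^2 + 40 a b + 9 b^2 is (20 a + 9 b)^2 +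
   41 a^2. At other times a and b swap. *)
have := sqr_ge0 (20 * a + 9 * b); have := sqr_ge0 (20 * b + 9 * a).
have := sqr_ge0 a; have := sqr_ge0 b.
by case: ifP => _; lra.
Qed.

Lemma cex_posdef : uniformly_posdef cex.
Proof.
exists 10^-1 => [|t _]; first by rewrite invr_gt0.
split; first by rewrite /= tr_scalar_blocks Mt_tr.
rewrite /loewner_le -[Qmat _ _]addr0 -[Qmat _ _]scale1r.
rewrite -[X in _ + X - _](raddf0 (@scalar_mx R _)).
apply: psd_scalar_blocks_sub => [|v]; first exact: Mt_tr.
by have := cex_form_ge t v; lra.
Qed.

Lemma cex_hessian t x :
  hessian (objective cex t) x = 2 *: scalar_blocks (Mt t).
Proof.
by rewrite hessian_quadratic tr_scalar_blocks Mt_tr scaler_nat mulr2n.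
Qed.

Lemma cex_gradient_coord t x i :
  coord (gradient (objective cex t) x) i = 2 * \sum_j Mt t i j * coord x j.
Proof.
rewrite gradient_quadratic addr0 tr_scalar_blocks Mt_tr scalar_blocksD.
rewrite coord_mul mulr_sumr; apply: eq_bigr => j _.
by rewrite !mxE; ring.
Qed.

Lemma cex_bounded_derivatives : bounded_derivatives cex.
Proof.
(* On the unit box the gradient entries are at most 14 and 6 in absolute value, so its norm is below
   20. The Hessian 2 M has eigenvalues 6 - 4 sqrt 2 and 6 + 4 sqrt 2, which lie between 1/5 and
   12. *)
exists 20, 5^-1, 12; split=> [||| t x _ xX]; rewrite ?invr_gt0//; first by lra.
have x0 : `|coord x 0| <= 1 := xX 0.
have x1 : `|coord x 1| <= 1 := xX 1.
rewrite cex_hessian; split.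
- rewrite enorm_coord sum_ord2 !cex_gradient_coord !sum_ord2.
  have -> : 20 = Num.sqrt (20 ^+ 2) :> R by rewrite sqrtr_sqr ger0_norm.
  apply: ler_wsqrtr.
  move: x0 x1; rewrite !ler_norml => /andP[? ?] /andP[? ?].
  by rewrite /Mt; case: ifP => _; rewrite !mxE/=; nra.
- rewrite /loewner_le -[2 *: _]addr0 -(raddf0 (@scalar_mx R _)).
  apply: psd_scalar_blocks_sub => [|v]; first exact: Mt_tr.
  by have := cex_form_ge t v; lra.
- rewrite /loewner_le addrC -scaleNr -[_ + _]subr0.
  rewrite -(raddf0 (@scalar_mx R _)).
  apply: psd_scalar_blocks_sub => [|v]; first exact: Mt_tr.
  rewrite cex_form sum_ord2; set a := coord v 0; set b := coord v 1.
  (* The gap to 12 is 2 (a - 2 b)^2 + 2 b^2 at time 0 and 2 (2 a - b)^2 + 2 a^2 at other times. *)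
  have := sqr_ge0 (a - 2 * b); have := sqr_ge0 (2 * a - b).
  have := sqr_ge0 a; have := sqr_ge0 b.
  by case: ifP => _; lra.
Qed.

(** * Constraint set, Lipschitz bounds and sampling gaps *)

Lemma cex_polytopic_blocks : polytopic_blocks cex.
Proof.
move=> i /=; split.
- by exists 0; rewrite /= mxE normr0.
- rewrite [X in compact X](_ : _ =
    (fun a : R => const_mx a : 'cV[R]_1) @` `[-1, 1]%classic).
    apply: continuous_compact; last exact: segment_compact.
    apply: continuous_subspaceT; exact: const_mx_continuous.
  apply/seteqP; split=> [x /= x1|_ /= [a a1 <-]].
    exists (x 0 0); first by rewrite in_itv/= -ler_norml.
    by apply/colP => j; rewrite mxE (ord1 j).
  by move: a1; rewrite mxE in_itv ler_norml.
(* The two rows encode x <= 1 and -x <= 1. *)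
- exists 2, (\matrix_(j, k) (-1) ^+ j), (const_mx 1).
  apply/seteqP; split=> x /=; rewrite ler_norml.
    move=> /andP[? ?] j; rewrite !mxE big_ord1 !mxE.
    by case: j => [[|[|//]] ?] /=; lra.
  move=> xle; move: (xle 0) (xle 1).
  by rewrite !mxE !big_ord1 !mxE /=; lra.
Qed.

Lemma enorm0 n : enorm (0 : 'cV[R]_n) = 0.
Proof. by rewrite /enorm big1 ?sqrtr0// => i _; rewrite mxE expr0n. Qed.

Lemma opnorm0 m n : opnorm (0 : 'M[R]_(m, n)) = 0.
Proof.
rewrite /opnorm [X in sup X](_ : _ = [set 0]) ?sup1//.
apply/seteqP; split=> [_ [v _ <-]|_ ->]; first by rewrite mul0mx enorm0.
by exists 0; rewrite /= ?mul0mx enorm0.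
Qed.

(** This separation is what permits the jump of [Mt] after time 0: a function with finitely many
    values is Lipschitz on such a grid. *)
Lemma cex_grid_dist t t' : time_grid cex t -> time_grid cex t' ->
  t != t' -> 1 <= `|t - t'|.
Proof.
move=> /cex_gridP[l ->] /cex_gridP[l' ->].
rewrite eqr_nat; wlog lt_ll' : l l' / (l < l')%N.
  move=> wl /[dup]; rewrite {1}neq_ltn => /orP[/wl//|/wl].
  by rewrite distrC eq_sym.
by rewrite distrC -natrB 1?ltnW// normr_nat ler1n subn_gt0.
Qed.

Lemma cex_lipschitz_data : lipschitz_data cex.
Proof.
move=> i.
pose B (M : 'M[R]_2) := submxcol (scalar_blocks M) i : 'M[R]_(1, _).
(* The only nonzero differences of Q are M0 - M1 and M1 - M0. The absolute values make L nonnegative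
   and a bound for both; adding 1 makes the constant positive. *)
pose L := `|opnorm (B M0 - B M1)| + `|opnorm (B M1 - B M0)|.
exists (1 + L), 1; split=> // [|t t' tg t'g].
  by rewrite ltr_pwDl// addr_ge0.
split; last by rewrite /rblock subrr enorm0 mul1r.
have [<-|/(cex_grid_dist tg t'g) tt'] := eqVneq t t'.
  by rewrite !subrr normr0 mulr0 opnorm0.
have L0 : 0 <= 1 + L by rewrite ?addr_ge0.
apply: le_trans (ler_peMr L0 tt').
rewrite /Qblock/= /Mt; case: ifP => _; case: ifP => _;
  rewrite ?subrr ?opnorm0//.
- apply: le_trans (ler_norm _) _.
  by rewrite /L addrCA lerDl addr_ge0.
- apply: le_trans (ler_norm _) _.
  by rewrite /L addrA lerDr addr_ge0.
Qed.

Lemma cex_sampling_gaps : bounded_sampling_gaps cex.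
Proof.
(* The second agent's latest samples run 0, 0, 2, 3, and so on, so the largest gap is 2, from time 1
   to time 2. *)
exists 2 => // i z; rewrite /= !cex_latest.
case: eqP => _ /=; first by rewrite -natrB// subSn// subnn normr1; lra.
case: z => [|[|z]] /=; rewrite ?subrr ?normr0 ?subr0 ?normr_nat//.
by rewrite -natrB// subSn// subnn normr1; lra.
Qed.

(** * Nonconvexity of the aggregate at time 1 *)

Lemma cex_aggregate x :
  aggregate cex 1 x =
    coord x 0 ^+ 2 + 4 * coord x 0 * coord x 1 + coord x 1 ^+ 2.
Proof.
have -> : aggregate cex 1 x =
    quadratic (scalar_blocks (\matrix_(i, j) if i == j then 1 else 2)) 0 x.
  congr (quadratic _ _ x).
    rewrite [RHS]/scalar_blocks mxblockEv; apply: eq_mxcol => i.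
    rewrite /Qblock/= /scalar_blocks mxblockEv mxcolK; apply: eq_mxrow => j.
    rewrite -[1]/(1%:R) cex_latest /Mt mxE andbT.
    by case: (ord2P i) => ->; case: (ord2P j) => ->;
      rewrite /= ?eqxx ?oner_eq0 mxE.
  rewrite -[RHS](mxcol0 _ (p_ := fun _ : 'I_2 => 1%N)); apply: eq_mxcol => i.
  by rewrite /rblock submxcol0.
rewrite /quadratic trmx0 mul0mx [X in _ + X]mxE addr0.
rewrite form_scalar_blocks !sum_ord2 !mxE/=.
by ring.
Qed.

Lemma cex_nonconvex : ~ convex_function (feasible cex) (aggregate cex 1).
Proof.
(* The form a^2 + 4 a b + b^2 is negative along (1, -1), the direction joining these unit vectors:
   it is 1 at both of them but 3/2 at their midpoint. *)
pose x := block_col (fun i : 'I_2 => if i == 0 then 1 else 0 : R).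
pose y := block_col (fun i : 'I_2 => if i == 0 then 0 else 1 : R).
have xX : x \in feasible cex.
  by rewrite inE => i; rewrite /= mxcolK mxE; case: ifP;
    rewrite ?normr1 ?normr0.
have yX : y \in feasible cex.
  by rewrite inE => i; rewrite /= mxcolK mxE; case: ifP;
    rewrite ?normr1 ?normr0.
have half : 0 <= (2^-1 : R) <= 1 by lra.
move=> /(_ (Itv01 (andP half).1 (andP half).2) _ _ xX yX).
rewrite [X in aggregate _ _ X](_ : _ = 2^-1 *: x + 2^-1 *: y); last first.
  by congr (_ + _ *: _); rewrite /unstable.onem /=; lra.
rewrite convRE/= /unstable.onem !cex_aggregate !coord_lin !coord_block_col/=.
by lra.
Qed.

End Counterexample.

Theorem theorem1 (R : realType) :
  exists P : sampled_problem R,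
    [/\ well_formed P /\ bounded_derivatives P,
        uniformly_posdef P,
        polytopic_blocks P,
        lipschitz_data P
      & bounded_sampling_gaps P] /\
    exists z : nat,
      ~ convex_function (feasible P) (aggregate P (stime P z)).
Proof.
exists (cex R); split; last by exists 1%N; exact: cex_nonconvex.
split; [split| | | |].
- exact: cex_well_formed.
- exact: cex_bounded_derivatives.
- exact: cex_posdef.
- exact: cex_polytopic_blocks.
- exact: cex_lipschitz_data.
- exact: cex_sampling_gaps.
Qed.
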